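(* Let $p\in(0,1)$, $\beta\in\mathbb{R}$, $l\ge1$ and $1\le n\le l$ be fixed, let $\theta=0$, and for $k\in\{0,\dots,3^n-1\}$ set $\alpha=\frac{k}{3^n}$. There exists a polynomial $R_{p,\beta,\frac{k}{3^n},0}$ of degree $3^n$ such that $$\sigma\Big(H^{(l)}_{p,\beta,\frac{k}{3^n},0}\Big)=R^{-1}_{p,\beta,\frac{k}{3^n},0}\Big(\sigma(\Delta_p^{(l-n)})\setminus\sigma(\Delta^{(0)})\Big)\ \cup\ \sigma\Big(H^{(n)}_{p,\beta,\frac{k}{3^n},0}\Big).$$ Furthermore, for $n=1$ and $k\in\{1,2\}$ the polynomial is $$R_{p,\beta,\frac{k}{3},0}(z)=\frac{(-\beta+2p-2z)\,(\beta^2+2\beta p+\beta z-2pz-2p-2z^2+2)}{4p(1-p)}.$$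
   Context: For $x\in\mathbb{Z}_+\setminus\{0\}$ let $m(x)$ be the largest integer $m\ge0$ with $3^m\mid x$. For $x\ge1$ set $p(x,x-1)=1-p,\ p(x,x+1)=p$ if $3^{-m(x)}x\equiv1\pmod3$, and $p(x,x-1)=p,\ p(x,x+1)=1-p$ if $3^{-m(x)}x\equiv2\pmod3$. Let $V_l=\{0,1,\dots,3^l\}$. The level-$l$ self-similar almost Mathieu operator $H^{(l)}_{p,\beta,\alpha,\theta}$ acts on $f:V_l\to\mathbb{C}$ by $(H^{(l)}f)(0)=\beta\cos(\theta)f(0)-f(1)$, $(H^{(l)}f)(3^l)=\beta\cos(2\pi\alpha3^l+\theta)f(3^l)-f(3^l-1)$, and for $1\le x\le 3^l-1$: $(H^{(l)}f)(x)=\beta\cos(2\pi\alpha x+\theta)f(x)-p(x,x-1)f(x-1)-p(x,x+1)f(x+1)$; it is regarded as a $(3^l+1)\times(3^l+1)$ matrix and $\sigma$ denotes its set of eigenvalues. The level-$l$ Laplacian $\Delta^{(l)}_p$ on $V_l$ is $(\Delta^{(l)}_pf)(0)=f(0)-f(1)$, $(\Delta_p^{(l)}f)(x)=f(x)-p(x,x-1)f(x-1)-p(x,x+1)f(x+1)$ for $1\le x\le3^l-1$, and $(\Delta^{(l)}_pf)(3^l)=f(3^l)-f(3^l-1)$; in particular $\Delta^{(0)}=\begin{pmatrix}1&-1\\-1&1\end{pmatrix}$, with $\sigma(\Delta^{(0)})=\{0,2\}$. For a polynomial $R$ and a set $A$, $R^{-1}(A)=\{z\in\mathbb{C}: R(z)\in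 A\}$. *)

(* Defs.v *)
From HB Require Import structures.
From mathcomp Require Import all_boot all_order all_algebra.
From mathcomp Require Import all_classical all_reals.
From mathcomp Require Import trigo.
From mathcomp Require Import complex.
Set Implicit Arguments. Unset Strict Implicit. Unset Printing Implicit Defensive.
Import Order.TTheory GRing.Theory Num.Theory.
Local Open Scope ring_scope.
Local Open Scope classical_set_scope.

Definition m3 (x : nat) : nat := logn 3 x.

Definition res3 (x : nat) : nat := ((x %/ 3 ^ m3 x) %% 3)%N.

Definition pfwd {R : realType} (p : R) (x : nat) : R :=
  if res3 x == 1%N then p else 1 - p.
Definition pbwd {R : realType} (p : R) (x : nat) : R :=
  if res3 x == 1%N then 1 - p else p.

(* Off-diagonal coefficients of the operators on V_l = {0,...,3^l}:
   coefficient of f(x+1) in (Hf)(x) is -cfwd, of f(x-1) is -cbwd. *)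
Definition cfwd {R : realType} (p : R) (x : nat) : R :=
  if x == 0%N then 1 else pfwd p x.
Definition cbwd {R : realType} (p : R) (l x : nat) : R :=
  if x == (3 ^ l)%N then 1 else pbwd p x.

Definition jacobi_mx {R : realType} (p : R) (l : nat) (d : nat -> R)
  : 'M[R]_((3 ^ l).+1) :=
  \matrix_(i, j)
    (if (j : nat) == i then d i
     else if (j : nat) == i.+1 then - cfwd p i
     else if (j.+1 == i) then - cbwd p l i
     else 0).

Definition Hmx {R : realType} (p beta alpha theta : R) (l : nat) :=
  jacobi_mx p l (fun x => beta * cos (2 * pi * alpha * x%:R + theta)).

Definition Lapmx {R : realType} (p : R) (l : nat) := jacobi_mx p l (fun _ => 1).

Definition spectrum {R : realType} {N : nat} (A : 'M[R]_N.+1) : set R[i] :=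
  [set z | eigenvalue (map_mx (fun r : R => (r%:C)%C) A) z].

Definition poly_preim {R : realType} (P : {poly R}) (A : set R[i]) : set R[i] :=
  [set z | A (map_poly (fun r : R => (r%:C)%C) P).[z]].

Definition R_explicit {R : realType} (p beta : R) : {poly R} :=
  ((4 * p * (1 - p))^-1) *:
  ((((- beta + 2 * p)%:P) - 2%:P * 'X) *
   ((beta ^+ 2 + 2 * beta * p - 2 * p + 2)%:P + (beta - 2 * p)%:P * 'X
    - 2%:P * 'X ^+ 2)).

(* Main.v *)
(* The coefficients on the blocks {N j, ..., N (j+1)}, N = 3^n, of V_l do not
   depend on j and are symmetric under r -> N - r.  Let c, s be the solutions of
   the eigenvalue equation on one block with (c(0), c(1)) = (1, 0) and
   (s(0), s(1)) = (0, 1).  An eigenfunction f for z satisfies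
   f(N (j+1)) = c(N) f(N j) + s(N) f(N j + 1) together with the reflected relation,
   and eliminating the neighbours of the nodes N j shows, when s(N) <> 0, that
   j -> f(N j) is an eigenfunction of the Laplacian of level l - n for the value
   R(z) = 1 - c(N) - (beta - z) s(N).  In particular z is an eigenvalue of H^(n)
   iff R(z) is 0 or 2, and both belong to every Laplacian spectrum.
   When s(N) = 0 the Wronskian gives c(N)^2 = 1, so R(z) is 0 or 2 and the node
   values are c(N)^j f(0).  The defect of the boundary condition is then
   propagated from node to node with positive weights, so it vanishes at the last
   node iff it vanishes at the first one, i.e. iff z is an eigenvalue of H^(n). *)
Require Import Defs.
From HB Require Import structures.
From mathcomp Require Import all_boot all_order all_algebra.
From mathcomp Require Import all_classical all_reals.
From mathcomp Require Import trigo.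
From mathcomp Require Import complex.
From mathcomp Require Import ring.
Import Order.TTheory GRing.Theory Num.Theory.
Local Open Scope ring_scope.
Local Open Scope classical_set_scope.

(** * Three-term recurrences on an interval and their eigenfunctions *)

(* Here [e x] stands for [d x - z], the shifted diagonal; the end points have
   off-diagonal coefficient 1. *)
Definition solves {F : fieldType} (a b e : nat -> F) (M : nat) (f : nat -> F) :=
  forall x, (0 < x < M)%N -> e x * f x = b x * f x.-1 + a x * f x.+1.

Definition neumann {F : fieldType} (a b e : nat -> F) (M : nat) (f : nat -> F) :=
  [/\ e 0%N * f 0%N = f 1%N, solves a b e M f & e M * f M = f M.-1].

Lemma solves_shift {F : fieldType} {a b e : nat -> F} {N M : nat} {f} (j : nat) :
  (forall i r, (0 < r < N)%N ->
     [/\ a (N * i + r)%N = a r, b (N * i + r)%N = b r & e (N * i + r)%N = e r]) ->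
  solves a b e (N * M) f -> (j < M)%N ->
  solves a b e N (fun r => f (N * j + r)%N).
Proof.
move=> per sol jM r rN; have [pa pb pe] := per j r rN.
have /andP[r0 rN'] := rN.
have H : (0 < N * j + r < N * M)%N.
  rewrite addn_gt0 r0 orbT /=; apply: (@leq_trans (N * j.+1)).
    by rewrite mulnS addnC ltn_add2r.
  by rewrite leq_mul2l jM orbT.
have := sol _ H; rewrite pa pb pe addnS => ->.
by case: r r0 {rN rN' pa pb pe H} => // r _; rewrite addnS.
Qed.

Lemma solves_rev {F : fieldType} {a b e : nat -> F} {N : nat} {f} :
  (forall r, (0 < r < N)%N -> a (N - r)%N = b r /\ e (N - r)%N = e r) ->
  solves a b e N f -> solves a b e N (fun r => f (N - r)%N).
Proof.
move=> sym sol r rN; have [ab ee] := sym r rN.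
have /andP[r0 rN'] := rN.
have H : (0 < N - r < N)%N by rewrite subn_gt0 rN' ltn_subrL r0 (leq_trans _ rN').
(* The hypothesis speaks of [a] at a reflected point only; used at [N - r] it also gives
   [b (N - r) = a r]. *)
have [ba _] := sym _ H; rewrite subKn ?(ltnW rN') // in ba.
have := sol _ H; rewrite ee ab -ba => ->.
rewrite addrC; congr (_ * f _ + _ * f _).
  by case: r r0 rN' {rN H ab ba ee} => // r _ rN; rewrite subnSK 1?ltnW.
by rewrite subnS.
Qed.

Lemma solves_uniq {F : fieldType} {a b e : nat -> F} {M : nat} {f g} :
  (forall x, (0 < x)%N -> a x != 0) ->
  solves a b e M f -> solves a b e M g -> f 0%N = g 0%N -> f 1%N = g 1%N ->
  forall x, (x <= M)%N -> f x = g x.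
Proof.
move=> a0 sf sg e0 e1 x; elim/ltn_ind: x => -[|[|x]] // IH xM.
have H : (0 < x.+1 < M)%N by [].
have E1 : f x.+1 = g x.+1 by apply: IH => //; exact: ltnW.
have E2 : f x = g x by apply: IH => //; do 2!apply: ltnW.
apply: (mulfI (a0 x.+1 isT)); apply: (addrI (b x.+1 * f x)).
by rewrite -(sf _ H) E1 (sg _ H) E2.
Qed.

(* [a'] is the inverse of the forward coefficient; keeping it as a separate
   argument lets the recursion run over polynomials in the spectral parameter. *)
Section Shoot.
Context {A : pzRingType} (a' b e : nat -> A) (u0 u1 : A).

Fixpoint shoot_pair (r : nat) : A * A :=
  if r is r'.+1 then
    let: (u, v) := shoot_pair r' in (v, a' r * (e r * v - b r * u))
  else (u0, u1).

Definition shoot (r : nat) : A := (shoot_pair r).1.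

Lemma shoot0 : shoot 0 = u0. Proof. by []. Qed.
Lemma shoot1 : shoot 1 = u1. Proof. by []. Qed.

Lemma shootSS r :
  shoot r.+2 = a' r.+1 * (e r.+1 * shoot r.+1 - b r.+1 * shoot r).
Proof. by rewrite /shoot /=; case: shoot_pair. Qed.
End Shoot.

(** Meant for evaluation at a spectral value, which carries polynomial solutions to numerical
    ones. *)
Lemma rmorph_shoot {A B : pzRingType} (f : {rmorphism A -> B})
    (a' b e : nat -> A) (u0 u1 : A) r :
  f (shoot a' b e u0 u1 r) = shoot (f \o a') (f \o b) (f \o e) (f u0) (f u1) r.
Proof.
elim/ltn_ind: r => -[|[|r]] // IH.
by rewrite !shootSS rmorphM rmorphB !rmorphM !IH.
Qed.

Lemma shoot_solves {F : fieldType} {a a' b e : nat -> F} (u0 u1 : F) M :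
  (forall x, (0 < x)%N -> a x * a' x = 1) ->
  solves a b e M (shoot a' b e u0 u1).
Proof. by move=> aV [|x] // _; rewrite shootSS mulrA aV // mul1r addrC subrK. Qed.

(** When the forward coefficients are nonzero, [g 0 != 0] just says that [g] is not zero: with
    [g 0 = 0] the left boundary condition and the recurrence make [g] vanish. *)
Definition is_eigen {F : fieldType} (a b e : nat -> F) (M : nat) :=
  exists g, g 0%N != 0 /\ neumann a b e M g.

(* By uniqueness of the solution with given initial data, a single solution
   decides whether there is an eigenfunction. *)
Lemma neumannP {F : fieldType} {a b e : nat -> F} {M : nat} {f} :
  (0 < M)%N -> (forall x, (0 < x)%N -> a x != 0) ->
  f 0%N = 1 -> f 1%N = e 0%N -> solves a b e M f ->
  is_eigen a b e M <-> e M * f M = f M.-1.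
Proof.
move=> M0 ha f0 f1 sf; split=> [[g [g0 [b0 sg bM]]]|bM]; last first.
  by exists f; split; [rewrite f0 oner_neq0 | split; rewrite // f0 mulr1].
have E : forall x, (x <= M)%N -> g x = g 0%N * f x.
  apply: (@solves_uniq F a b e) => //.
  - move=> x xM; rewrite mulrCA (sf _ xM); ring.
  - by rewrite f0 mulr1.
  - by rewrite f1 -b0 mulrC.
apply: (mulfI g0); rewrite -(E M.-1) ?leq_pred // mulrCA -E //.
Qed.

(** * Decimation of an abstract recurrence with periodic, reflection-symmetric blocks *)

Section Decimation.
Context {F : numFieldType} (a b e C S : nat -> F) (N : nat).
Hypotheses (N0 : (0 < N)%N).
Hypotheses (a0 : forall x, (0 < x)%N -> 0 < a x).
Hypotheses (b0 : forall x, (0 < x)%N -> 0 < b x).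
Hypotheses (ab1 : forall x, (0 < x)%N -> a x + b x = 1).
Hypothesis per : forall i r, (0 < r < N)%N ->
  [/\ a (N * i + r)%N = a r, b (N * i + r)%N = b r & e (N * i + r)%N = e r].
Hypothesis sym : forall r, (0 < r < N)%N -> a (N - r)%N = b r /\ e (N - r)%N = e r.
Hypothesis scale : forall j, (0 < j)%N -> a (N * j)%N = a j /\ b (N * j)%N = b j.
Hypothesis scale_e : forall j, e (N * j)%N = e 0%N.
Hypotheses (C0 : C 0%N = 1) (C1 : C 1%N = 0) (Csol : solves a b e N C).
Hypotheses (S0 : S 0%N = 0) (S1 : S 1%N = 1) (Ssol : solves a b e N S).

Let an0 x : (0 < x)%N -> a x != 0. Proof. by move=> /a0 /lt0r_neq0. Qed.

Lemma solves_basis {f} : solves a b e N f ->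
  forall r, (r <= N)%N -> f r = f 0%N * C r + f 1%N * S r.
Proof.
move=> sf; apply: (solves_uniq an0 sf); last 2 first.
- by rewrite C0 S0 mulr1 mulr0 addr0.
- by rewrite C1 S1 mulr1 mulr0 add0r.
by move=> r rN; rewrite mulrDr !(mulrCA (e r)) (Csol _ rN) (Ssol _ rN); ring.
Qed.

Lemma solves_basis_rev {f} : solves a b e N f ->
  forall r, (r <= N)%N -> f (N - r)%N = f N * C r + f N.-1 * S r.
Proof.
by move=> /(solves_rev sym)/solves_basis H r /H ->; rewrite subn0 subn1.
Qed.

Lemma prod_sym : \prod_(1 <= r < N) a r = \prod_(1 <= r < N) b r.
Proof.
rewrite big_nat_rev /= !big_nat; apply: eq_bigr => r rN.
by rewrite add1n subSS; case: (sym _ rN).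
Qed.

(** The determinant [C r.+1 * S r - C r * S r.+1] starts at -1 and gains the factor
    [b r.+1 / a r.+1] at each step. By [prod_sym] these factors multiply to 1 over the block. *)
Lemma wronskian : C N * S N.-1 - C N.-1 * S N = -1.
Proof.
have W r : (r < N)%N -> (\prod_(1 <= i < r.+1) a i) * (C r.+1 * S r - C r * S r.+1)
     = - \prod_(1 <= i < r.+1) b i.
  elim: r => [|r IH] rN; first by rewrite !big_geq // C0 C1 S0 S1; ring.
  rewrite !(@big_nat_recr _ _ _ r.+1) //= -[RHS]mulNr -IH ?(ltnW rN) //.
  have rN' : (0 < r.+1 < N)%N by [].
  have := Csol _ rN'; have := Ssol _ rN' => /= eS eC.
  have -> : (\prod_(1 <= i < r.+1) a i * a r.+1) *
      (C r.+2 * S r.+1 - C r.+1 * S r.+2) =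
      \prod_(1 <= i < r.+1) a i * ((b r.+1 * C r + a r.+1 * C r.+2) * S r.+1
       - C r.+1 * (b r.+1 * S r + a r.+1 * S r.+2)
       + b r.+1 * (C r.+1 * S r - C r * S r.+1)) by ring.
  by rewrite -eS -eC; ring.
have := W N.-1; rewrite prednK // leqnn => /(_ isT); rewrite prod_sym => H.
have P0 : \prod_(1 <= i < N) b i != 0.
  rewrite big_nat lt0r_neq0 // prodr_gt0 // => i /andP[i0 _]; exact: b0.
by apply: (mulfI P0); rewrite H mulrN1.
Qed.

(** [C] is expanded from the right end of the block and read off at the left end, where it is 1. *)
Lemma basis_inv : C N ^+ 2 + S N * C N.-1 = 1.
Proof.
have := solves_basis_rev Csol N (leqnn N); rewrite subnn C0 => ->.
by rewrite expr2 [S N * _]mulrC.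
Qed.

(** The map from [(f 0, f 1)] to [(f N, f N.-1)] is an involution of determinant -1, so its trace
    vanishes. *)
Lemma basis_trace : S N = 0 -> S N.-1 = - C N.
Proof.
move=> SN; have := wronskian; have := basis_inv; rewrite SN mul0r addr0 mulr0 subr0.
move=> C2 E; rewrite -[LHS]mul1r -C2 expr2 -mulrA E; ring.
Qed.

(** This is 1 - R(z), the shifted diagonal of the Laplacian equation satisfied by the node
    values. *)
Let T : F := C N + e 0%N * S N.

(** * The solution fixed by the left boundary condition, followed from node to node *)

Section Level.
Context (M : nat) (u : nat -> F).
Hypotheses (M0 : (0 < M)%N) (u0 : u 0%N = 1) (u1 : u 1%N = e 0%N).
Hypothesis usol : solves a b e (N * M) u.

Lemma block_up j : (j < M)%N ->
  u (N * j.+1)%N = u (N * j)%N * C N + u (N * j).+1 * S N.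
Proof.
move=> jM; have /= := solves_basis (solves_shift j per usol jM) N (leqnn N).
by rewrite addn0 addn1 mulnS addnC.
Qed.

Lemma block_up_pred j : (j < M)%N ->
  u (N * j.+1).-1 = u (N * j)%N * C N.-1 + u (N * j).+1 * S N.-1.
Proof.
move=> jM.
have /= := solves_basis (solves_shift j per usol jM) N.-1 (leq_pred N).
rewrite addn0 addn1 => <-; congr u.
by rewrite mulnS -{1}(prednK N0) addSn addnC.
Qed.

Lemma block_down j : (j < M)%N ->
  u (N * j)%N = u (N * j.+1)%N * C N + u (N * j.+1).-1 * S N.
Proof.
move=> jM.
have /= := solves_basis_rev (solves_shift j per usol jM) N (leqnn N).
rewrite subnn addn0 => ->; congr (u _ * _ + u _ * _); first by rewrite mulnS addnC.
by rewrite mulnS -{3}(prednK N0) addSn addnC.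
Qed.

Lemma at_node j : (0 < j < M)%N -> e 0%N * u (N * j)%N =
  b j * u (N * j).-1 + a j * u (N * j).+1.
Proof.
case/andP=> j0 jM; have H : (0 < N * j < N * M)%N by rewrite muln_gt0 N0 j0 ltn_pmul2l.
by have := usol _ H; rewrite scale_e; have [-> ->] := scale _ j0.
Qed.

Lemma coarse_init : u (N * 1)%N = T.
Proof. by rewrite block_up // muln0 u0 u1 /T; ring. Qed.

(** [block_up] and [block_down] express [S N] times the two neighbours of a node through node
    values, so [at_node] times [S N] involves nodes only. The identity [a + b = 1] distributes the
    term in [C N] over both sides. *)
Lemma coarse_solves : solves a b (fun=> T) M (fun j => u (N * j)%N).
Proof.
move=> j jM; have /andP[j0 jM'] := jM.
have E := at_node _ jM.
case: j j0 jM jM' E => // j _ jM jM' E /=.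
have := block_down j (ltnW jM'); have := block_up j.+1 jM' => EU ED.
have -> : T * u (N * j.+1)%N = C N * u (N * j.+1)%N + S N * (e 0%N * u (N * j.+1)%N).
  by rewrite /T; ring.
rewrite E EU ED.
have -> : C N * u (N * j.+1)%N = (a j.+1 + b j.+1) * (C N * u (N * j.+1)%N).
  by rewrite ab1 // mul1r.
ring.
Qed.

(** On the last block [block_down] turns the fine condition times [S N] into the coarse one, and
    [S N] cancels. *)
Lemma coarse_end : S N != 0 ->
  e (N * M)%N * u (N * M)%N = u (N * M).-1 <-> T * u (N * M)%N = u (N * M.-1)%N.
Proof.
move=> SN; rewrite scale_e.
have jM : (M.-1 < M)%N by rewrite prednK.
have := block_down _ jM; rewrite prednK // => ->.
have E : T * u (N * M)%N = u (N * M)%N * C N + (e 0%N * u (N * M)%N) * S N.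
  by rewrite /T; ring.
by rewrite E; split=> [->//|/addrI/(mulIf SN)].
Qed.

Lemma defect : S N = 0 -> forall j, (j < M)%N -> exists2 c : F, 0 < c &
  u (N * j.+1).-1 - e 0%N * u (N * j.+1)%N =
    c * (C N ^+ j.+1 * (C N * C N.-1 - e 0%N *+ 2)).
Proof.
move=> SN; have tr := basis_trace SN.
have C2 : C N ^+ 2 = 1 by have := basis_inv; rewrite SN mul0r addr0.
have C2' : C N * C N = 1 by rewrite -expr2.
have nodes j : (j <= M)%N -> u (N * j)%N = C N ^+ j.
  elim: j => [|j IH] jM; first by rewrite muln0 u0 expr0.
  by rewrite block_up // SN mulr0 addr0 IH ?(ltnW jM) // exprSr.
have D : C N.-1 = C N * (C N * C N.-1) by rewrite mulrA C2' mul1r.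
elim=> [|j IH] jM.
  exists 1 => //; rewrite block_up_pred // (nodes 1%N) // muln0 u0 u1 tr expr1 {1}D.
  ring.
have [c c0 E] := IH (ltnW jM).
have A := a0 j.+1 isT; have B := b0 j.+1 isT.
(* The block itself contributes 1. Since [a + b = 1], the node equation turns the incoming defect
   into an outgoing one with factor [- (b / a)], and [S N.-1 = - C N] restores the sign. *)
exists (1 + b j.+1 / a j.+1 * c).
  by rewrite addr_gt0 // mulr_gt0 // divr_gt0.
have := at_node j.+1 jM; rewrite (block_up_pred j.+1) // !nodes ?(ltnW jM) //.
set h := u (N * j.+1).-1 in E *; set g := u (N * j.+1).+1 => node.
have G : g - e 0%N * C N ^+ j.+1 = - (b j.+1 / a j.+1) * (h - e 0%N * C N ^+ j.+1).
  apply: (mulfI (an0 j.+1 isT)); rewrite mulrA mulrN mulrCA divff ?an0 // mulr1.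
  have -> : a j.+1 * (g - e 0%N * C N ^+ j.+1) =
    a j.+1 * g - (a j.+1 + b j.+1 - b j.+1) * (e 0%N * C N ^+ j.+1) by ring.
  by rewrite ab1 // mulrBl mul1r node; ring.
rewrite nodes ?(ltnW jM) // in E; rewrite E in G.
have {G} -> : g = e 0%N * C N ^+ j.+1 - b j.+1 / a j.+1 *
  (c * (C N ^+ j.+1 * (C N * C N.-1 - e 0%N *+ 2))).
  by rewrite -mulNr -G; ring.
by rewrite tr (exprS _ j.+1) {1}D; ring.
Qed.

(** The right-hand condition does not involve [M]: the positive factor and the power of [C N], which
    is 1 or -1, only rescale the defect. *)
Lemma neumann_degenerate : S N = 0 ->
  e (N * M)%N * u (N * M)%N = u (N * M).-1 <-> C N * C N.-1 - e 0%N *+ 2 = 0.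
Proof.
move=> SN; have C2 : C N ^+ 2 = 1 by have := basis_inv; rewrite SN mul0r addr0.
have CN : C N != 0 by apply: contra_eq_neq C2 => ->; rewrite expr0n eq_sym oner_neq0.
have jM : (M.-1 < M)%N by rewrite prednK.
have [c c0] := defect SN _ jM; rewrite prednK // scale_e => E.
split=> [H|H]; last by apply/esym/eqP; rewrite -subr_eq0 E H !mulr0.
move: E; rewrite H subrr => /esym/eqP.
by rewrite !mulf_eq0 (gt_eqF c0) expf_eq0 (negPf CN) andbF => /eqP.
Qed.
End Level.

Let u : nat -> F := shoot (fun x => (a x)^-1) b e 1 (e 0%N).

Let usol M : solves a b e M u.
Proof. by apply: shoot_solves => x x0; rewrite divff ?an0. Qed.

(** One function serves both levels: [neumannP] applied to [u] and to its node values reduces the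
    claim to [coarse_end]. *)
Lemma eigen_decimation M : (0 < M)%N -> S N != 0 ->
  is_eigen a b e (N * M) <-> is_eigen a b (fun=> T) M.
Proof.
move=> M0 SN; have us := usol (N * M).
have NM : (0 < N * M)%N by rewrite muln_gt0 N0.
have [E1 E2] := (neumannP NM an0 (erefl : u 0%N = 1) (erefl : u 1%N = e 0%N) us,
  neumannP (f := fun j => u (N * j)%N) M0 an0 (congr1 u (muln0 N))
   (coarse_init M u M0 erefl erefl us) (coarse_solves M u us)).
have E3 := coarse_end M u M0 us SN.
exact: (iff_trans E1 (iff_trans E3 (iff_sym E2))).
Qed.

Lemma eigen_degenerate M : (0 < M)%N -> S N = 0 ->
  is_eigen a b e (N * M) <-> is_eigen a b e N.
Proof.
move=> M0 SN.
suff H M' : (0 < M')%N -> is_eigen a b e (N * M') <-> C N * C N.-1 - e 0%N *+ 2 = 0.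
  by have H1 := H 1%N isT; rewrite muln1 in H1; exact: (iff_trans (H M M0) (iff_sym H1)).
move=> M0'; have us := usol (N * M').
have NM : (0 < N * M')%N by rewrite muln_gt0 N0.
have E1 := neumannP NM an0 (erefl : u 0%N = 1) (erefl : u 1%N = e 0%N) us.
have E2 := neumann_degenerate M' u M0' erefl erefl us SN.
exact: (iff_trans E1 E2).
Qed.

Lemma degenerate_T : S N = 0 -> T ^+ 2 = 1.
Proof. by move=> SN; have := basis_inv; rewrite /T SN mul0r mulr0 !addr0. Qed.

(** For w = 1 - t the condition reads w = 0 or w = 2, the spectrum of the level 0 Laplacian. *)
Lemma eigen_level0 (t : F) : is_eigen a b (fun=> t) 1 <-> t ^+ 2 = 1.
Proof.
have s : solves a b (fun=> t) 1 (fun i => t ^+ i) by case.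
by have := neumannP (ltn0Sn 0) an0 (expr0 t) (expr1 t) s; rewrite expr1 expr2.
Qed.

(** For t = 1 and t = -1 the eigenfunctions are the constant and the alternating function. *)
Lemma eigen_level0_sub (t : F) M : (0 < M)%N -> t ^+ 2 = 1 -> is_eigen a b (fun=> t) M.
Proof.
move=> M0 t2; exists (fun i => t ^+ i); split; first by rewrite expr0 oner_neq0.
have tt x : (0 < x)%N -> t * t ^+ x = t ^+ x.-1.
  by case: x => // x _; rewrite -exprS -addn2 exprD t2 mulr1.
split; [by rewrite expr0 expr1 mulr1| |exact: tt].
move=> x /andP[x0 _]; rewrite tt // exprS tt //.
by rewrite -mulrDl addrC ab1 // mul1r.
Qed.

Lemma is_eigen_blocks M : (0 < M)%N ->
  is_eigen a b e (N * M) <->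
  ((is_eigen a b (fun=> T) M /\ ~ is_eigen a b (fun=> T) 1) \/ is_eigen a b e N).
Proof.
move=> M0; have [SN|SN] := eqVneq (S N) 0.
  split=> [/(eigen_degenerate M M0 SN)|[[_]|]]; first by right.
    by case; apply/eigen_level0/degenerate_T.
  by move=> ?; apply/eigen_degenerate.
(* With a single block, decimation shows that [is_eigen a b e N] holds exactly when [T ^+ 2 = 1],
   the case removed on the coarse side. *)
have HM := eigen_decimation M M0 SN; have := eigen_decimation 1 isT SN.
rewrite muln1 => H1; split=> [/HM H|[[? _]|/H1]]; last 2 first.
- exact/HM.
- by move=> /eigen_level0/(eigen_level0_sub _ _ M0)/HM.
have [t1|t1] := eqVneq (T ^+ 2) 1; first by right; apply/H1/eigen_level0.
by left; split=> // /eigen_level0/eqP; apply/negP.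
Qed.
End Decimation.

(** * Scaling, periodicity and reflection of the ternary residues *)

Lemma res3_coprime m q : ~~ (3 %| q)%N -> res3 (3 ^ m * q) = (q %% 3)%N.
Proof.
move=> q3; have q0 : (0 < q)%N by case: q q3.
have mq : m3 (3 ^ m * q) = m.
  by rewrite /m3 lognM ?expn_gt0 // pfactorK // lognE (negPf q3) !andbF addn0.
by rewrite /res3 mq mulKn // expn_gt0.
Qed.

Lemma coprime_decomp x : (0 < x)%N ->
  exists m q, ~~ (3 %| q)%N /\ x = (3 ^ m * q)%N.
Proof.
move=> x0; have [q q3 ->] := pfactor_coprime (isT : prime 3) x0.
by exists (logn 3 x), q; rewrite mulnC; split=> //; rewrite prime_coprime in q3.
Qed.

Lemma res3_scale n x : (0 < x)%N -> res3 (3 ^ n * x) = res3 x.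
Proof.
by move=> /coprime_decomp [m [q [q3 ->]]]; rewrite mulnA -expnD !res3_coprime.
Qed.

(** Since r < 3^n, a factor 3 survives in 3^n once 3^m is divided out. Hence adding a multiple of
    3^n to r keeps q modulo 3, and reflecting r negates it. *)
Lemma coprime_decomp_lt n r : (0 < r < 3 ^ n)%N ->
  exists m q s, [/\ ~~ (3 %| q)%N, r = (3 ^ m * q)%N & (3 ^ n = 3 ^ m * (3 * s))%N].
Proof.
move=> /andP[r0 rn]; have [m [q [q3 E]]] := coprime_decomp r r0.
have q0 : (0 < q)%N by case: (q) q3.
have mn : (m < n)%N.
  rewrite -(@ltn_exp2l 3) //; apply: leq_ltn_trans rn.
  by rewrite E leq_pmulr.
exists m, q, (3 ^ (n - m).-1)%N; split=> //.
by rewrite -expnS prednK ?subn_gt0 // -expnD subnKC // ltnW.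
Qed.

Lemma res3_per n i r : (0 < r < 3 ^ n)%N -> res3 (3 ^ n * i + r) = res3 r.
Proof.
move=> /coprime_decomp_lt [m [q [s [q3 -> ->]]]].
rewrite -!mulnA -mulnDr !res3_coprime //; last by rewrite dvdn_addr ?dvdn_mulr.
by rewrite -modnDml modnMr.
Qed.

Lemma res3_sym n r : (0 < r < 3 ^ n)%N ->
  (res3 (3 ^ n - r) == 1%N) = ~~ (res3 r == 1%N).
Proof.
move=> rn; have /andP[r0 rn'] := rn.
have [m [q [s [q3 rE nE]]]] := coprime_decomp_lt n r rn.
have qs : (q <= 3 * s)%N.
  by rewrite -(@leq_pmul2l (3 ^ m)) ?expn_gt0 // -nE -rE ltnW.
have q3' : ~~ (3 %| 3 * s - q)%N by rewrite dvdn_subr ?dvdn_mulr.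
rewrite nE rE -mulnBr !res3_coprime //.
(* Two nonzero residues with sum 0 modulo 3: exactly one of them is 1. *)
have : ((3 * s - q) %% 3 + q %% 3 = 0 %[mod 3])%N.
  by rewrite modnDm subnK // mulnC modnMl.
move: q3 q3'; rewrite /dvdn.
move: (ltn_pmod q (isT : (0 < 3)%N)) (ltn_pmod (3 * s - q) (isT : (0 < 3)%N)).
by case: (q %% 3)%N => [|[|[|]]] //; case: ((3 * s - q) %% 3)%N => [|[|[|]]].
Qed.

(** * From matrix eigenvalues to solutions of the recurrence *)

Lemma eigenvalue_col {F : fieldType} {n : nat} (A : 'M[F]_n) (z : F) :
  eigenvalue A z <-> exists2 v : 'cV_n, A *m v = z *: v & v != 0.
Proof.
(* [eigenvalue] refers to row vectors; transposing [A - z] preserves its rank. *)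
have -> : eigenvalue A z = eigenvalue A^T z.
  rewrite /eigenvalue /eigenspace !kermx_eq0 /row_free -[in RHS]mxrank_tr.
  by rewrite linearB /= trmxK tr_scalar_mx.
split=> [/eigenvalueP|] [v vA v0].
  by exists v^T; rewrite ?trmx_eq0 // -[A]trmxK -trmx_mul vA linearZ.
by apply/eigenvalueP; exists v^T; rewrite ?trmx_eq0 // -trmx_mul vA linearZ.
Qed.

Section Spectrum.
Context {R : realType} (p : R).
Local Notation toC := (real_complex R).

(** The end-point coefficients 1 of [cfwd] and [cbwd] are left to the boundary conditions in
    [neumann]. *)
Definition fwdC (x : nat) : R[i] := toC (pfwd p x).
Definition bwdC (x : nat) : R[i] := toC (pbwd p x).

Lemma fwd_bwd1 x : fwdC x + bwdC x = 1.
Proof.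
rewrite /fwdC /bwdC -rmorphD /pfwd /pbwd; case: ifP => _.
  by rewrite subrKC rmorph1.
by rewrite subrK rmorph1.
Qed.

Lemma jacobi_mx_col l (d : nat -> R) (f : nat -> R[i]) (i : 'I_(3 ^ l).+1) :
  \sum_j map_mx toC (jacobi_mx p l d) i j * f j =
  toC (d i) * f i - (if (i < 3 ^ l)%N then toC (cfwd p i) * f i.+1 else 0)
  - (if (0 < i)%N then toC (cbwd p l i) * f i.-1 else 0).
Proof.
transitivity (\sum_(j < (3 ^ l).+1)
   ((if (j : nat) == i then toC (d i) * f j else 0)
    - (if (j : nat) == i.+1 then toC (cfwd p i) * f j else 0)
    - (if (0 < i)%N && ((j : nat) == i.-1) then toC (cbwd p l i) * f j else 0))).
  apply: eq_bigr => j _; rewrite !mxE.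
  (* The guard [0 < i] matters because [i.-1] is 0 at [i = 0]. *)
  have -> : (j.+1 == i)%N = (0 < i)%N && ((j : nat) == i.-1) by case: (i : nat).
  case: eqP => [->|_].
    rewrite (ltn_eqF (ltnSn i)); case: (i : nat) => [|k] /=; rewrite ?subr0 //.
    by rewrite (gtn_eqF (ltnSn k)) !subr0.
  case: eqP => [->|_].
    have -> : (0 < i)%N && (i.+1 == i.-1) = false.
      by rewrite (gtn_eqF (leq_ltn_trans (leq_pred i) (ltnSn i))) andbF.
    by rewrite rmorphN mulNr sub0r subr0.
  by case: ifP => _; rewrite ?rmorphN ?rmorph0 ?mulNr ?mul0r !sub0r ?oppr0 ?add0r.
rewrite !sumrB -!big_mkcond /=.
rewrite (big_ord1_eq _ (fun j => toC (d i) * f j)).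
rewrite (big_ord1_eq _ (fun j => toC (cfwd p i) * f j)) ltn_ord ltnS.
congr (_ - _ - _); case: ltnP => i0.
  rewrite (big_ord1_eq _ (fun j => toC (cbwd p l i) * f j)).
  by rewrite (leq_ltn_trans (leq_pred _)).
by rewrite big_pred0.
Qed.

Lemma spectrum_jacobi l (d : nat -> R) (z : R[i]) : 0 < p < 1 ->
  spectrum (jacobi_mx p l d) z <->
  is_eigen fwdC bwdC (fun x => toC (d x) - z) (3 ^ l).
Proof.
move=> /andP[p0 p1].
have M0 : (0 < 3 ^ l)%N by rewrite expn_gt0.
have a0 x : (0 < x)%N -> fwdC x != 0.
  move=> _; rewrite /fwdC fmorph_eq0 /pfwd; case: ifP => _; first exact: lt0r_neq0.
  by rewrite lt0r_neq0 // subr_gt0.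
pose eqs (f : nat -> R[i]) := forall i : 'I_(3 ^ l).+1,
  toC (d i) * f i - (if (i < 3 ^ l)%N then toC (cfwd p i) * f i.+1 else 0)
  - (if (0 < i)%N then toC (cbwd p l i) * f i.-1 else 0) = z * f i.
have E f : neumann fwdC bwdC (fun x => toC (d x) - z) (3 ^ l) f <-> eqs f.
  split=> [[h0 hs hM] i|H].
    have [iM|Mi|iM] := ltngtP i (3 ^ l)%N.
    - case: posnP => [i0|i0].
        rewrite i0 /cfwd eqxx rmorph1 mul1r subr0 -h0; ring.
      have iM' : (0 < i < 3 ^ l)%N by rewrite i0.
      rewrite /cfwd /cbwd (gtn_eqF i0) (ltn_eqF iM).
      have := hs _ iM'; rewrite /fwdC /bwdC mulrBl => /eqP.
      rewrite subr_eq => /eqP ->; ring.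
    - by have := ltn_ord i; rewrite ltnS leqNgt Mi.
    - rewrite iM M0 /cbwd eqxx rmorph1 mul1r subr0 -hM; ring.
  split.
  - have := H ord0; rewrite /= M0 /cfwd eqxx rmorph1 mul1r subr0 mulrBl => <-; ring.
  - move=> x xM; have /andP[x0 xM'] := xM.
    have := H (Ordinal (ltnW xM' : (x < (3 ^ l).+1)%N)).
    rewrite /= xM' x0 /cfwd /cbwd (gtn_eqF x0) (ltn_eqF xM') mulrBl => <-.
    rewrite /fwdC /bwdC; ring.
  - have := H ord_max; rewrite /= ltnn M0 /cbwd eqxx rmorph1 mul1r mulrBl => <-; ring.
rewrite /spectrum /=; split.
  move=> /eigenvalue_col [v vA v0].
  (* Beyond [3 ^ l] the values come from the default of [inord]; the equations never read them. *)
  pose f x : R[i] := v (inord x) 0.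
  have fE (i : 'I_(3 ^ l).+1) : f i = v i 0 by rewrite /f inord_val.
  have H : eqs f.
    move=> i; rewrite -jacobi_mx_col fE.
    have := congr1 (fun w : 'cV_ _ => w i 0) vA; rewrite !mxE => <-.
    by apply: eq_bigr => j _; rewrite fE.
  have nf := (E f).2 H; exists f; split=> //.
  apply: contra_neq v0 => f0; have [h0 hs _] := nf.
  have Z : forall x, (x <= 3 ^ l)%N -> f x = 0.
    apply: (solves_uniq (g := fun=> 0) a0 hs) => //; last by rewrite -h0 f0 mulr0.
    by move=> x _; rewrite !mulr0 addr0.
  apply/colP => i; rewrite mxE -fE; apply: Z; rewrite -ltnS; exact: ltn_ord.
case=> f [f0 /E H]; apply/eigenvalue_col.
exists (\col_i f i); last first.
  by apply: contra_neq f0 => /colP /(_ ord0); rewrite !mxE.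
apply/colP => i; rewrite !mxE -H -jacobi_mx_col.
by apply: eq_bigr => j _; rewrite [(\col_i _) _ _]mxE.
Qed.
End Spectrum.

(** * The decimation polynomial, its degree and the spectral identity *)

Section DecimationPolynomial.
Context {R : realType} (p : R) (d : nat -> R).

Definition block_sol (u0 u1 : {poly R}) : nat -> {poly R} :=
  shoot (fun x => ((pfwd p x)^-1)%:P) (fun x => (pbwd p x)%:P)
    (fun x => (d x)%:P - 'X) u0 u1.

(* If [c] and [s] solve the eigenvalue equation on a block with
   [(c 0, c 1) = (1, 0)] and [(s 0, s 1) = (0, 1)], the node values of an
   eigenfunction satisfy the Laplacian equation with eigenvalue
   [1 - c N - (d 0 - z) * s N]. *)
Definition decimation_poly (N : nat) : {poly R} :=
  1 - block_sol 1 0 N - ((d 0%N)%:P - 'X) * block_sol 0 1 N.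

Hypothesis p01 : 0 < p < 1.

Lemma pfwd_gt0 x : 0 < pfwd p x.
Proof. by case/andP: p01 => ? ?; rewrite /pfwd; case: ifP; rewrite ?subr_gt0. Qed.

Lemma pbwd_gt0 x : 0 < pbwd p x.
Proof. by case/andP: p01 => ? ?; rewrite /pbwd; case: ifP; rewrite ?subr_gt0. Qed.

Lemma size_CsubX (c : R) : size (c%:P - 'X) = 2%N.
Proof. by rewrite -size_polyN opprB size_XsubC. Qed.

(** A crude bound suffices: it keeps this solution below the degree [N] of the last term of
    [decimation_poly]. *)
Lemma size_block_solC r : (size (block_sol 1%R 0%R r) <= maxn 1 r)%N.
Proof.
elim/ltn_ind: r => -[|[|r]] IH; rewrite ?size_poly1 ?size_poly0 //.
rewrite /block_sol shootSS -/(block_sol 1 0) mul_polyC.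
apply: leq_trans (size_scale_leq _ _) _; apply: leq_trans (size_polyD _ _) _.
rewrite size_polyN geq_max; apply/andP; split.
  apply: leq_trans (size_polyMleq _ _) _; rewrite size_CsubX /=.
  by rewrite ltnS; have := IH r.+1 (ltnSn _); rewrite !maxnSS !max0n.
rewrite mul_polyC; apply: leq_trans (size_scale_leq _ _) _.
apply: leq_trans (IH r _) _; first exact: ltnW.
by rewrite maxnSS max0n geq_max /= ltnW.
Qed.

(** Each step multiplies by a polynomial of degree 1 and a nonzero constant, while the subtracted
    term has lower degree. *)
Lemma size_block_solS r : size (block_sol 0%R 1%R r) = r.
Proof.
elim/ltn_ind: r => -[|[|r]] IH; rewrite ?size_poly1 ?size_poly0 //.
rewrite /block_sol shootSS -/(block_sol 0 1) mul_polyC.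
rewrite size_scale ?invr_neq0 ?lt0r_neq0 ?pfwd_gt0 //.
have s1 : size (((d r.+1)%:P - 'X) * block_sol 0%R 1%R r.+1) = r.+2.
  by rewrite size_mul -?size_poly_gt0 ?size_CsubX ?IH.
rewrite size_polyDl // s1 size_polyN mul_polyC.
apply: leq_ltn_trans (size_scale_leq _ _) _.
by rewrite IH // ltnW.
Qed.

Lemma size_decimation_poly N : (0 < N)%N -> size (decimation_poly N) = N.+1.
Proof.
move=> N0; have s1 : size (((d 0%N)%:P - 'X) * block_sol 0 1 N) = N.+1.
  by rewrite size_mul -?size_poly_gt0 ?size_CsubX ?size_block_solS.
rewrite /decimation_poly addrC size_polyDl size_polyN s1 //.
apply: leq_ltn_trans (size_polyD _ _) _.
rewrite size_polyN size_poly1 ltnS geq_max N0.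
by apply: leq_trans (size_block_solC N) _; rewrite geq_max N0 leqnn.
Qed.

Local Notation toC := (real_complex R).

Lemma spectrum_decimation n l : (n <= l)%N ->
  (forall x y : nat, (x = y %[mod 3 ^ n])%N -> d x = d y) ->
  (forall r, (r <= 3 ^ n)%N -> d (3 ^ n - r)%N = d r) ->
  spectrum (jacobi_mx p l d) =
    poly_preim (decimation_poly (3 ^ n))
      (spectrum (Lapmx p (l - n)) `\` spectrum (Lapmx p 0))
    `|` spectrum (jacobi_mx p n d).
Proof.
move=> nl dper dsym; apply/predeqP => z.
have [ev evE] : exists ev : {rmorphism {poly R} -> R[i]},
    forall q, ev q = (map_poly toC q).[z].
  by exists (horner_eval z \o map_poly toC).
pose e x : R[i] := toC (d x) - z.
pose C x := ev (block_sol 1 0 x); pose S x := ev (block_sol 0 1 x).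
have N0 : (0 < 3 ^ n)%N by rewrite expn_gt0.
have a0 x : (0 < x)%N -> 0 < fwdC p x by rewrite ltcR pfwd_gt0.
have b0 x : (0 < x)%N -> 0 < bwdC p x by rewrite ltcR pbwd_gt0.
have evC c : ev c%:P = toC c by rewrite evE map_polyC hornerC.
have evX : ev 'X = z by rewrite evE map_polyX hornerX.
have sol u0 u1 : solves (fwdC p) (bwdC p) e (3 ^ n) (fun x => ev (block_sol u0 u1 x)).
  have -> : (fun x => ev (block_sol u0 u1 x)) =
     shoot (fun x => (fwdC p x)^-1) (bwdC p) e (ev u0) (ev u1).
    apply/funext => x; rewrite rmorph_shoot; congr (shoot _ _ _ _ _ _).
    - by apply/funext => y; rewrite /= evC fmorphV.
    - by apply/funext => y; rewrite /= evC.
    - by apply/funext => y; rewrite /= rmorphB evC evX.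
  by apply: shoot_solves => x x0; rewrite divff // lt0r_neq0 ?a0.
have fsym r : (0 < r < 3 ^ n)%N -> fwdC p (3 ^ n - r) = bwdC p r /\ e (3 ^ n - r)%N = e r.
  move=> rn; have /andP[_ /ltnW rn'] := rn.
  rewrite /fwdC /bwdC /pfwd /pbwd /e res3_sym // dsym //; split=> //.
  by case: ifP => [/negPf ->|/negbFE ->].
have fper i r : (0 < r < 3 ^ n)%N -> [/\ fwdC p (3 ^ n * i + r) = fwdC p r,
    bwdC p (3 ^ n * i + r) = bwdC p r & e (3 ^ n * i + r)%N = e r].
  move=> rn; rewrite /fwdC /bwdC /pfwd /pbwd /e res3_per //; split=> //.
  by rewrite (dper _ r) // mulnC modnMDl.
have fscale j : (0 < j)%N -> fwdC p (3 ^ n * j) = fwdC p j /\ bwdC p (3 ^ n * j) = bwdC p j.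
  by move=> j0; rewrite /fwdC /bwdC /pfwd /pbwd res3_scale.
have escale j : e (3 ^ n * j)%N = e 0%N by rewrite /e (dper _ 0%N) // modnMr mod0n.
have [C0 C1] : C 0%N = 1 /\ C 1%N = 0 by rewrite /C rmorph1 rmorph0.
have [S0 S1] : S 0%N = 0 /\ S 1%N = 1 by rewrite /S rmorph1 rmorph0.
have M0 : (0 < 3 ^ (l - n))%N by rewrite expn_gt0.
have := is_eigen_blocks _ _ _ C S _ N0 a0 b0 (fun x _ => fwd_bwd1 p x) fper fsym fscale
  escale C0 C1 (sol _ _) S0 S1 (sol _ _) _ M0.
rewrite -expnD subnKC //.
have PE : ev (decimation_poly (3 ^ n)) = 1 - (C (3 ^ n)%N + e 0%N * S (3 ^ n)%N).
  by rewrite /decimation_poly !rmorphB rmorphM rmorphB rmorph1 evC evX opprD addrA.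
(* The Laplacian has diagonal 1, so at the spectral value R(z) its shifted diagonal is 1 - R(z). *)
have lapE m : is_eigen (fwdC p) (bwdC p) (fun=> C (3 ^ n)%N + e 0%N * S (3 ^ n)%N) (3 ^ m)
    <-> spectrum (Lapmx p m) (map_poly toC (decimation_poly (3 ^ n))).[z].
  rewrite spectrum_jacobi // -evE PE rmorph1.
  by rewrite subKr.
have [L1 L2] := lapE (l - n)%N; have [Z1 Z2] := lapE 0%N.
have [H1 H2] := spectrum_jacobi p l d z p01; have [K1 K2] := spectrum_jacobi p n d z p01.
move=> [E1 E2]; split=> [/H1/E1[[/L1 ? nz]|/K2 ?]|[[/L2 ? nz]|/K1 ?]].
- by left; split=> // /Z2.
- by right.
- by apply/H2/E2; left; split=> // /Z1.
- by apply/H2/E2; right.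
Qed.
End DecimationPolynomial.

(** * Cosines at rational frequencies *)

Lemma cos_mod {R : realType} (k N x : nat) : (0 < N)%N ->
  cos (2 * pi * (k%:R / N%:R) * x%:R + 0 : R) =
  cos (2 * pi * (k%:R / N%:R) * (x %% N)%:R + 0).
Proof.
move=> N0; rewrite -[RHS](periodicn (@cosD2pi R) (k * (x %/ N))); congr cos.
rewrite {1}(divn_eq x N); field.
by rewrite pnatr_eq0 -lt0n.
Qed.

Lemma cos_reflect {R : realType} (k N r : nat) : (0 < N)%N -> (r <= N)%N ->
  cos (2 * pi * (k%:R / N%:R) * (N - r)%:R + 0 : R) =
  cos (2 * pi * (k%:R / N%:R) * r%:R + 0).
Proof.
move=> N0 rN; rewrite -[RHS]cosN -[RHS](periodicn (@cosD2pi R) k); congr cos.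
rewrite natrB //; field.
by rewrite pnatr_eq0 -lt0n.
Qed.

Lemma cos_2pi3 {R : realType} : cos (2 * pi / 3 : R) = - 2^-1.
Proof.
set q : R := 2 * pi / 3; set c := cos q.
have c0 : c < 0.
  have -> : c = - sin (pi / 6).
    by rewrite -cosDpihalf /c /q; congr cos; field.
  rewrite oppr_lt0 sin_gt0_pi // divr_gt0 ?pi_gt0 //=.
  by rewrite ltr_pdivrMr // ltr_pMr ?pi_gt0 // (ltr_nat _ 1 6).
(* Doubling 2 pi / 3 gives its negative up to a full turn, so [c] is a root of 2 c^2 - c - 1; its
   sign excludes the root 1. *)
have E : c ^+ 2 *+ 2 - 1 = c.
  rewrite -cos_mulr2n -[RHS]cosN -[RHS](cosD2pi (- q)); congr cos.
  by rewrite /q; field.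
have /eqP : (c - 1) * (2 * c + 1) = 0.
  have -> : (c - 1) * (2 * c + 1) = c ^+ 2 *+ 2 - 1 - c by ring.
  by rewrite E subrr.
rewrite mulf_eq0 subr_eq0 => /orP[/eqP c1|/eqP c2].
  by move: c0; rewrite c1 ltr10.
have -> : c = (2 * c + 1 - 1) / 2 by field.
by rewrite c2; field.
Qed.

Lemma cos_third {R : realType} (k x : nat) : (k = 1 \/ k = 2)%N -> (x = 1 \/ x = 2)%N ->
  cos (2 * pi * (k%:R / 3) * x%:R + 0 : R) = - 2^-1.
Proof.
have c2 : cos (2 * pi / 3 *+ 2 : R) = - 2^-1.
  by rewrite cos_mulr2n cos_2pi3; field.
case=> -> [] ->.
- by rewrite -cos_2pi3; congr cos; field.
- by rewrite -c2; congr cos; field.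
- by rewrite -c2; congr cos; field.
have -> : 2 * pi * (2%:R / 3) * 2%:R + 0 = 2 * pi / 3 *+ 2 *+ 2 :> R.
  by field.
by rewrite cos_mulr2n c2; field.
Qed.

(** * The explicit polynomial for one ternary step, and the theorem *)

Lemma R_explicitE {R : realType} (p beta : R) (d : nat -> R) : 0 < p < 1 ->
  d 0%N = beta -> d 1%N = beta * - 2^-1 -> d 2%N = beta * - 2^-1 ->
  decimation_poly p d 3 = R_explicit p beta.
Proof.
move=> /andP[p0 p1] d0 d1 d2.
have p0' : p != 0 by rewrite lt0r_neq0.
have q0' : 1 - p != 0 by rewrite subr_eq0 gt_eqF.
have r1 : res3 1 = 1%N by rewrite -[1%N]/(3 ^ 0 * 1)%N res3_coprime.
have r2 : res3 2 = 2%N by rewrite -[2%N]/(3 ^ 0 * 2)%N res3_coprime.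
have c0 : 4 * p * (1 - p) != 0 by rewrite !mulf_neq0 // pnatr_eq0.
apply: (scalerI c0); rewrite /R_explicit scalerA divff // scale1r.
rewrite /decimation_poly /block_sol !shootSS /pfwd /pbwd r1 r2 /= d0 d1 d2.
(* Halving [beta] clears the fraction in the cosine values, leaving an identity with integer
   coefficients. *)
have [h ->] : exists h, beta = 2 * h by exists (beta / 2); field.
have -> : 2 * h * - 2^-1 = - h by field.
have pP : p%:P * (p^-1)%:P = 1 by rewrite -polyCM divff.
have qQ : (1 - p%:P) * ((1 - p)^-1)%:P = 1 by rewrite -polyCB -polyCM divff.
rewrite !shoot0 !shoot1 -mul_polyC !(polyCM, polyCD, polyCN, rmorphXn).
move: (p^-1)%:P ((1 - p)^-1)%:P pP qQ => P' Q' pP qQ.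
(* The terms are grouped so that the inverses [P'] and [Q'] occur only in products equal to 1. *)
transitivity (4 * (p%:P * (1 - p%:P) + (p%:P * P') * ((1 - p%:P) * Q') *
    ((1 - p%:P) * (- h%:P - 'X) - (2 * h%:P - 'X) * (- h%:P - 'X) ^+ 2)
    + (2 * h%:P - 'X) * p%:P ^+ 2 * ((1 - p%:P) * Q'))).
  ring.
rewrite pP qQ; ring.
Qed.

Theorem theorem3p1 (R : realType) (p beta : R) (l n k : nat) :
  0 < p < 1 -> (1 <= l)%N -> (1 <= n <= l)%N -> (k < 3 ^ n)%N ->
  let alpha : R := k%:R / (3 ^ n)%:R in
  (exists P : {poly R},
      size P = (3 ^ n).+1 /\
      spectrum (Hmx p beta alpha 0 l) =
        poly_preim P (spectrum (Lapmx p (l - n)) `\` spectrum (Lapmx p 0))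
        `|` spectrum (Hmx p beta alpha 0 n))
  /\
  (n = 1%N -> (k = 1%N \/ k = 2%N) ->
      spectrum (Hmx p beta alpha 0 l) =
        poly_preim (R_explicit p beta)
          (spectrum (Lapmx p (l - n)) `\` spectrum (Lapmx p 0))
        `|` spectrum (Hmx p beta alpha 0 n)).
Proof.
move=> p01 _ /andP[_ nl] _ alpha.
pose d x : R := beta * cos (2 * pi * alpha * x%:R + 0).
have N0 : (0 < 3 ^ n)%N by rewrite expn_gt0.
have spec : spectrum (Hmx p beta alpha 0 l) =
    poly_preim (decimation_poly p d (3 ^ n))
      (spectrum (Lapmx p (l - n)) `\` spectrum (Lapmx p 0))
    `|` spectrum (Hmx p beta alpha 0 n).
  apply: spectrum_decimation => // [x y xy|r rN]; rewrite /d.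
    by rewrite (cos_mod _ _ x N0) (cos_mod _ _ y N0) xy.
  by rewrite cos_reflect.
split; first by exists (decimation_poly p d (3 ^ n)); rewrite size_decimation_poly.
move=> n1 k12; rewrite {1}spec n1 (R_explicitE p beta) // /d /alpha n1.
- by rewrite mulr0 addr0 cos0 mulr1.
- by rewrite cos_third //; left.
- by rewrite cos_third //; right.
Qed.
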